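(* Let $G$ be a Polish group with a near-action on a standard Borel space with a probability measure $(X,\mathcal{X},\mu)$. (a) If the near-action is whirly, then all $G$-continuous functions in $L^\infty(\mu)$ are constants (almost everywhere). (b) If the near-action is whirly, then it has no spatial model; moreover, it cannot have nontrivial spatial factors.
   Context: Near-action: for a Polish group $G$ and a standard Borel space with a probability measure $(X,\mathcal{X},\mu)$, a near-action is a Borel map $G\times X\to X$, $(g,x)\mapsto gx$, such that (i) $ex=x$ for almost every $x$, where $e$ is the identity of $G$; (ii) for each pair $g,h\in G$, $g(hx)=(gh)x$ for almost every $x$ (the null set may depend on $g,h$); (iii) each $g\in G$ preserves $\mu$. For $B\in\mathcal{X}$, $gB$ denotes the set $\{x: g^{-1}x\in B\}$, defined mod 0. Whirly: a near-action is whirly if for all $A,B\in\mathcal{X}$ of positive measure, every neighborhood of $e$ in $G$ contains $g$ such that $\mu(A\cap gB)>0$. (Equivalently: for all such $A,B$, $\mu(A\cap gB)>0$ for all $g$ outside a meager subset of $G$.) $G$-continuous function: $f\in L^\infty(\mu)$ is $G$-continuous if $f\circ g_n$ converges to $f$ in the $L^\infty(\mu)$ norm whenever $g_n\to e$ in $G$, where $(f\circ g)(x)=f(gx)$. Spatial model: a spatial $G$-action is a Borel map $G\times Y\to Y$ on a standard Lebesgue space (standard Borel probability space) $(Y,\mathcal{Y},\nu)$ with $ey=y$ and $g(hy)=(gh)y$ for all $g,h\in G$ and all $y\in Y$, such that each $g$ preserves $\nu$. Every spatial action is also a near-action. A spatial model of a near-action on $(X,\mathcal{X},\mu)$ is a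 spatial action on some $(Y,\mathcal{Y},\nu)$ which, as a near-action, is isomorphic to the given one: there is an invertible mod 0 measure preserving map $\varphi:X\to Y$ such that for each $g\in G$, $\varphi(gx)=g\varphi(x)$ for almost every $x$ (the null set may depend on $g$). Factors: a factor of the near-action is the near-action of $G$ determined by a $G$-invariant (mod 0) sub-$\sigma$-algebra $\mathcal{D}\subset\mathcal{X}$; equivalently, a near-action on some standard probability space $(Y,\nu)$ with a measure preserving map $\pi:X\to Y$ satisfying $\pi(gx)=g\pi(x)$ for a.e. $x$, for each $g\in G$. It is a spatial factor if it admits a spatial model, and nontrivial if $\mathcal{D}$ contains a set of measure strictly between $0$ and $1$ (equivalently, $\nu$ is not concentrated at a single point).
   Formalization: In (b), ''it has no spatial model'' is stated only when some set has measure strictly between 0 and 1: on a space whose measure is a point mass every near-action is whirly and has the one-point spatial model, so the claim fails there. *)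

(* Defs.v *)
From HB Require Import structures.
From mathcomp Require Import all_boot all_order all_algebra.
From mathcomp Require Import all_classical all_reals all_analysis.

Set Implicit Arguments.
Unset Strict Implicit.
Unset Printing Implicit Defensive.

Import Order.TTheory GRing.Theory Num.Theory.
Import numFieldNormedType.Exports.

Local Open Scope classical_set_scope.
Local Open Scope ring_scope.

(* The base point is arbitrary (it need not be the identity): it is there only
   because measurable types, hence [borel G] below, are pointed. *)
HB.structure Definition PreTopologicalGroup :=
  {G of Group G & PointedTopological G}.

HB.mixin Record PreTopologicalGroup_isTopologicalGroup G
    of PreTopologicalGroup G := {
  mulg_continuous : continuous (fun x : G * G => (x.1 * x.2)%g) ;
  invg_continuous : continuous (fun x : G => (x^-1)%g)
}.

#[short(type="topologicalGroupType")]
HB.structure Definition TopologicalGroup :=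
  {G of PreTopologicalGroup G & PreTopologicalGroup_isTopologicalGroup G}.

Definition separable_space (T : topologicalType) : Prop :=
  exists2 D : set T, countable D & dense D.

Record complete_compatible_metric (R : realType) (T : topologicalType)
    (dist : T -> T -> R) : Prop := {
  ccm_xx : forall x, dist x x = 0 ;
  ccm_eq : forall x y, dist x y = 0 -> x = y ;
  ccm_sym : forall x y, dist x y = dist y x ;
  ccm_triangle : forall x y z, dist x z <= dist x y + dist y z ;
  ccm_nbhs : forall (x : T) (A : set T),
    nbhs x A <-> exists2 e : R, 0 < e & [set y | dist x y < e] `<=` A ;
  ccm_complete : forall u : nat -> T,
    (forall e : R, 0 < e ->
       exists N, forall m n, (N <= m)%N -> (N <= n)%N -> dist (u m) (u n) < e) ->
    exists l : T, u @ \oo --> l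
}.

Definition polish_space (R : realType) (T : topologicalType) : Prop :=
  separable_space T /\
  exists dist : T -> T -> R, complete_compatible_metric dist.

Notation borel T := (g_sigma_algebraType (@open T)).

(* [X] is Borel isomorphic to a Polish space through [f]; the equivalence gives
   the measurability of [f] and of its inverse. *)
Definition standard_borel (R : realType) (d : measure_display)
    (X : measurableType d) : Prop :=
  exists (T : topologicalType) (f : X -> T),
    [/\ polish_space R T, bijective f &
        forall B : set T, <<s @open T >> B <-> measurable (f @^-1` B)].

Section maps.
Context (R : realType) (d d' : measure_display).
Context (X : measurableType d) (Y : measurableType d').
Variables (mu : probability X R) (nu : probability Y R).

Definition measure_preserving (f : X -> Y) : Prop :=
  measurable_fun [set: X] f /\
  forall B : set Y, measurable B -> mu (f @^-1` B) = nu B.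

Definition invertible_mod0 (f : X -> Y) : Prop :=
  exists h : Y -> X, [/\ measurable_fun [set: Y] h,
    {ae mu, forall x, h (f x) = x} & {ae nu, forall y, f (h y) = y}].

End maps.

Section actions.
Context (R : realType) (G : topologicalGroupType).
Context (d : measure_display) (X : measurableType d).
Variables (mu : probability X R) (a : G -> X -> X).

Definition borel_action_map : Prop :=
  measurable_fun [set: borel G * X] (fun p : borel G * X => a p.1 p.2).

Record near_action : Prop := {
  near_action_borel : borel_action_map ;
  near_action1 : {ae mu, forall x, a 1%g x = x} ;
  near_actionM : forall g h : G,
    {ae mu, forall x, a g (a h x) = a (g * h)%g x} ;
  near_action_preserving : forall g : G, measure_preserving mu mu (a g)
}.

Record spatial_action : Prop := {
  spatial_action_borel : borel_action_map ;
  spatial_action1 : forall x, a 1%g x = x ;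
  spatial_actionM : forall (g h : G) x, a g (a h x) = a (g * h)%g x ;
  spatial_action_preserving : forall g : G, measure_preserving mu mu (a g)
}.

Definition translate (g : G) (B : set X) : set X := [set x | B (a (g^-1)%g x)].

Definition whirly : Prop :=
  forall A B : set X, measurable A -> measurable B ->
    (0 < mu A)%E -> (0 < mu B)%E ->
  forall U : set G, nbhs (1%g : G) U ->
  exists2 g, U g & (0 < mu (A `&` translate g B))%E.

Definition G_continuous (f : X -> R) : Prop :=
  forall g_ : nat -> G, g_ @ \oo --> (1%g : G) ->
  'N[mu]_+oo%E[(fun x => (f (a (g_ n) x) - f x)%:E)]%E @[n --> \oo] --> 0%E.

End actions.

Definition equivariant_mod0 (R : realType) (G : topologicalGroupType)
    (d d' : measure_display) (X : measurableType d) (Y : measurableType d')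
    (mu : probability X R) (a : G -> X -> X) (b : G -> Y -> Y) (f : X -> Y) :
    Prop :=
  forall g : G, {ae mu, forall x, f (a g x) = b g (f x)}.

Definition isomorphic_near_actions (R : realType) (G : topologicalGroupType)
    (d d' : measure_display) (X : measurableType d) (Y : measurableType d')
    (mu : probability X R) (a : G -> X -> X)
    (nu : probability Y R) (b : G -> Y -> Y) : Prop :=
  exists f : X -> Y, [/\ measure_preserving mu nu f, invertible_mod0 mu nu f &
    equivariant_mod0 mu a b f].

Definition has_spatial_model (R : realType) (G : topologicalGroupType)
    (d : measure_display) (X : measurableType d)
    (mu : probability X R) (a : G -> X -> X) : Prop :=
  exists (d' : measure_display) (Y : measurableType d')
    (nu : probability Y R) (b : G -> Y -> Y),
    [/\ standard_borel R Y, spatial_action nu b &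
        isomorphic_near_actions mu a nu b].

(* [f] corresponds to the invariant sub-sigma-algebra of the [f @^-1` B]. *)
Definition near_action_factor (R : realType) (G : topologicalGroupType)
    (d d' : measure_display) (X : measurableType d) (Y : measurableType d')
    (mu : probability X R) (a : G -> X -> X)
    (nu : probability Y R) (b : G -> Y -> Y) : Prop :=
  [/\ standard_borel R Y, near_action nu b &
      exists2 f : X -> Y, measure_preserving mu nu f & equivariant_mod0 mu a b f].

Definition nontrivial_probability (R : realType) (d : measure_display)
    (X : measurableType d) (mu : probability X R) : Prop :=
  exists2 B : set X, measurable B & (0 < mu B < 1)%E.

(* Main.v *)
Require Import Defs.
From HB Require Import structures.
From mathcomp Require Import all_boot all_order all_algebra.
From mathcomp Require Import all_classical all_reals all_analysis ess_sup_inf.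

(* Part (a): a non-constant [f] separates two non-null sets [f < s] and [t < f];
   whirliness yields group elements tending to 1 that move part of one onto part
   of the other, so [f \o g] stays at distance [t - s] from [f].

   Part (b): whirliness passes to factors and isomorphic copies, so let [b] be a
   whirly spatial action on [Y].  For [B] Borel in [Y] and [U] open in [G], the
   set [E_U] of those [y] for which [{g in U | g y in B}] is meager is measurable
   (Montgomery-Novikov).  If [W N] is included in [U] for a neighborhood [N] of 1,
   then [N] moves [E_U] into [E_W], so by whirliness [E_U] non-null forces [E_W]
   to be of full measure.  Hence, for almost all [y] and [z] and all [B] in a
   countable separating family, [{g | g y in B}] and [{g | g z in B}] agree up to
   a meager set (they have the Baire property).  By Baire's theorem some [g]
   satisfies [g y = g z], so that [y = z], and [Y] is trivial. *)

Set Implicit Arguments.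
Unset Strict Implicit.
Unset Printing Implicit Defensive.

Import Order.TTheory GRing.Theory Num.Theory.

Local Open Scope classical_set_scope.
Local Open Scope ring_scope.

(** * Baire category *)

Definition meager (T : topologicalType) (A : set T) : Prop :=
  exists2 O : nat -> set T, (forall n, open (O n) /\ dense (O n)) &
    A `<=` \bigcup_n ~` O n.

Definition baire_property (T : topologicalType) (A : set T) : Prop :=
  exists2 O : set T, open O & meager (A `\` O) /\ meager (O `\` A).

Definition baire_space (T : topologicalType) : Prop :=
  forall O : set T, open O -> O !=set0 -> ~ meager O.

Definition nat_basis (T : topologicalType) (V : nat -> set T) : Prop :=
  (forall n, open (V n)) /\
  forall x A, nbhs x A -> exists2 n, V n x & V n `<=` A.

Section category.
Variable T : topologicalType.
Implicit Types A B : set T.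

Lemma denseT : dense [set: T].
Proof. by move=> O [x Ox] _; exists x. Qed.

Lemma meagerS A B : A `<=` B -> meager B -> meager A.
Proof. by move=> AB [ O hO BO]; exists O => //; exact: subset_trans BO. Qed.

Lemma meager_bigcup (A : nat -> set T) :
  (forall n, meager (A n)) -> meager (\bigcup_n A n).
Proof.
move=> mA.
have /choice[ O hO] : forall n, exists O : nat -> set T,
    (forall k, open (O k) /\ dense (O k)) /\ A n `<=` \bigcup_k ~` O k.
  by move=> n; have [ O ? ?] := mA n; exists O.
(* Codes that decode to no pair get [setT], whose complement adds nothing. *)
exists (fun n => if unpickle n is Some p then O p.1 p.2 else setT).
  move=> n; case: (unpickle n) => [[i j]|] /=; first by have [] := hO i.
  by split; [exact: openT|exact: denseT].
move=> x [n _ Anx]; have [_ /(_ _ Anx)[k _ nO]] := hO n.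
by exists (pickle (n, k)) => //=; rewrite pickleK.
Qed.

Lemma meager0 : meager (set0 : set T).
Proof. by exists (fun=> setT) => // n; split; [exact: openT|exact: denseT]. Qed.

Lemma meagerU A B : meager A -> meager B -> meager (A `|` B).
Proof.
move=> mA mB; rewrite -bigcup2E; apply: meager_bigcup => -[|[|n]] //=.
exact: meager0.
Qed.

Lemma baire_property_open A : open A -> baire_property A.
Proof. by move=> oA; exists A => //; rewrite setDv; split; exact: meager0. Qed.

(** For [A] open this set is its boundary: [A] together with its exterior is open and dense. *)
Lemma meager_frontier A : open A -> meager (~` A `\` interior (~` A)).
Proof.
move=> oA; exists (fun=> A `|` interior (~` A)).
  move=> _; split; first by apply: openU => //; exact: open_interior.
  move=> O [x Ox] oO.
  have [[y [Oy Ay]]|OA] := pselect ((O `&` A) !=set0).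
    by exists y; split => //; left.
  exists x; split => //; right; apply: (filterS _ (open_nbhs_nbhs (conj oO Ox))).
  by move=> y Oy Ay; apply: OA; exists y.
by move=> x [nA ni]; exists 0%N => // -[].
Qed.

(** The complement of the open approximation [O] is closed; passing to its interior costs only the
    meager boundary of [O]. *)
Lemma baire_propertyC A : baire_property A -> baire_property (~` A).
Proof.
move=> [ O oO [m1 m2]]; exists (interior (~` O)); first exact: open_interior.
split.
  apply: (meagerS _ (meagerU m2 (meager_frontier oO))) => x [nA ni].
  by have [Ox|nOx] := pselect (O x); [left|right].
apply: (meagerS _ m1) => x [/interior_subset nO nnA].
by split => //; apply: contrapT.
Qed.

Lemma baire_property_bigcup (A : nat -> set T) :
  (forall n, baire_property (A n)) -> baire_property (\bigcup_n A n).
Proof.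
move=> bA.
have /choice[ O hO] : forall n, exists O : set T,
    [/\ open O, meager (A n `\` O) & meager (O `\` A n)].
  by move=> n; have [ O ? []] := bA n; exists O.
exists (\bigcup_n O n); first by apply: bigcup_open => n _; have [] := hO n.
split.
  apply: (@meagerS _ (\bigcup_n (A n `\` O n))).
    by move=> x [[n _ Anx] nO]; exists n => //; split=> // Ox; apply: nO; exists n.
  by apply: meager_bigcup => n; have [] := hO n.
apply: (@meagerS _ (\bigcup_n (O n `\` A n))).
  by move=> x [[n _ Anx] nO]; exists n => //; split=> // Ox; apply: nO; exists n.
by apply: meager_bigcup => n; have [] := hO n.
Qed.

Lemma baire_propertyD A B :
  baire_property A -> baire_property B -> baire_property (A `\` B).
Proof.
move=> bA bB; rewrite setDE -[A `&` _]setCK; apply: baire_propertyC.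
rewrite setCI -bigcup2E setCK; apply: baire_property_bigcup => -[|[|n]] //=.
  exact: baire_propertyC.
exact/baire_property_open/open0.
Qed.

(** [A] is meager outside its open approximation [O], so [U] must meet [O]; a basic set inside both
    works. *)
Lemma baire_property_localization (V : nat -> set T) A U :
  nat_basis V -> open U -> baire_property A -> ~ meager (U `&` A) ->
  exists n, [/\ V n !=set0, V n `<=` U & meager (V n `\` A)].
Proof.
move=> [oV bV] oU [ O oO [m1 m2]] nm.
have [[x UOx]|UO] := pselect ((U `&` O) !=set0); last first.
  exfalso; apply: nm; apply: (meagerS _ m1) => x [Ux Ax]; split => // Ox.
  by apply: UO; exists x.
have [n Vx VUO] := bV _ _ (open_nbhs_nbhs (conj (openI oU oO) UOx)).
exists n; split; first by exists x.
  by move=> y /VUO[].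
by apply: (meagerS _ m2) => y [/VUO[_ Oy] nA].
Qed.

End category.

(** * Polish spaces: countable bases and Baire's theorem *)

Section polish.
Context (R : realType) (T : topologicalType) (dist : T -> T -> R).
Hypothesis dist_ccm : complete_compatible_metric dist.

Lemma open_dist_ball x e : open [set y | dist x y < e].
Proof.
have [_ _ _ dT dN _] := dist_ccm.
rewrite openE => y /= xy; apply/dN; exists (e - dist x y).
  by rewrite subr_gt0.
by move=> z /= yz; rewrite (le_lt_trans (dT x y z))// addrC -ltrBrDr.
Qed.

Lemma separable_nat_basis : separable_space T -> exists V, @nat_basis T V.
Proof.
move=> [D cD dD]; have [d0 dE dC dT dN _] := dist_ccm.
have /countable_injP[f finj] := cD.
(* Balls of radius [1/(k+1)] about the points of [D], where [n] codes the pair of the index of the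
   centre and [k]. As [f] is injective on [D], the union has at most one centre. *)
exists (fun n => if unpickle n is Some p then
   \bigcup_(x in [set x | D x /\ f x = p.1]) [set y | dist x y < p.2.+1%:R^-1]
   else set0).
split=> [n|x A].
  case: (unpickle n) => [p|]; last exact: open0.
  by apply: bigcup_open => y _; exact: open_dist_ball.
move=> /dN[e e0 eA].
have [k] := ltr_add_invr (divr_gt0 e0 (ltr0Sn R 1)); rewrite add0r => ke.
have [c [/= xc Dc]] : ([set y | dist x y < k.+1%:R^-1] `&` D) !=set0.
  by apply: dD; [exists x; rewrite /= d0 invr_gt0|exact: open_dist_ball].
exists (pickle (f c, k)); rewrite pickleK /=.
  by exists c => //=; rewrite dC.
move=> y [c' [Dc' fc'] /= c'y]; apply: eA => /=.
have cc' : c' = c by apply: finj => //; rewrite inE.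
rewrite (le_lt_trans (dT x c y))// [e]splitr ltrD// ?(lt_trans xc)//.
by rewrite (lt_trans _ ke)// -cc'.
Qed.

(** Nested closed balls start inside [W], their radii tend to 0, and the ball of step [n.+1] lies
    inside [O n]. By completeness the centres converge, and the limit lies in [W] and in every
    [O n]. *)
Lemma complete_baire_space : baire_space T.
Proof.
have [d0 dE dC dT dN dcomplete] := dist_ccm.
move=> W oW [w Ww] [ O hO WO].
pose cball (s : T * R) := [set y | dist s.1 y <= s.2].
have half (z : R) : 0 < z -> z / 2 < z.
  by move=> z0; rewrite ltr_pdivrMr// ltr_pMr// ltr1n.
have shrink n (x : T) (U : set T) : U x -> open U ->
    exists s : T * R, [/\ 0 < s.2, s.2 < n.+1%:R^-1 & cball s `<=` U].
  move=> Ux oU; have /dN[e e0 eU] := open_nbhs_nbhs (conj oU Ux).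
  exists (x, Num.min (e / 2) (n.+1%:R^-1 / 2)); rewrite /=.
  split; first by rewrite lt_min !divr_gt0.
    by rewrite gt_min half ?orbT// invr_gt0.
  move=> y; rewrite /cball/= le_min => /andP[xy _]; apply: eU.
  exact: le_lt_trans xy (half _ e0).
have /choice[F FP] : forall p : nat * (T * R), exists s : T * R,
    0 < p.2.2 -> [/\ 0 < s.2, s.2 < p.1.+1%:R^-1 &
      cball s `<=` [set y | dist p.2.1 y < p.2.2] `&` O p.1].
  move=> [n [x r]] /=; have [r0|] := pselect (0 < r); last by exists (x, r).
  have [oO dO] := hO n.
  have [c [xc Oc]] : ([set y | dist x y < r] `&` O n) !=set0.
    by apply: dO; [exists x; rewrite /= d0|exact: open_dist_ball].
  have [s sP] := shrink n c _ (conj xc Oc) (openI (open_dist_ball _ _) oO).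
  by exists s.
have [s0 [s00 _ s0W]] := shrink 0%N w W Ww oW.
pose fix s n := if n is m.+1 then F (m, s m) else s0.
have sgt0 n : 0 < (s n).2.
  by elim: n => [//|n ih]; have [] := FP (n, s n) ih.
have sS n : [/\ (s n.+1).2 < n.+1%:R^-1, cball (s n.+1) `<=` cball (s n) &
                cball (s n.+1) `<=` O n].
  have [_ /= sn sub] := FP (n, s n) (sgt0 n).
  by split => // y /sub[]// /ltW.
have smono n k : cball (s (n + k)%N) `<=` cball (s n).
  elim: k => [|k ih]; first by rewrite addn0.
  by rewrite addnS; apply: subset_trans ih; have [] := sS (n + k)%N.
have ds n m : (n <= m)%N -> dist (s n).1 (s m).1 <= (s n).2.
  move=> /subnKC <-; apply: (smono n (m - n)%N).
  by rewrite /cball /= d0 ltW.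
have [|l ul] := dcomplete (fun n => (s n).1).
  move=> e e0.
  have [k] := ltr_add_invr (divr_gt0 e0 (ltr0Sn R 1)); rewrite add0r => ke.
  exists k.+1 => m n km kn; have [sk _ _] := sS k.
  rewrite (le_lt_trans (dT _ (s k.+1).1 _))// [e]splitr dC.
  by rewrite ltrD// (le_lt_trans (ds _ _ _))// (lt_trans sk).
(* If [l] were outside this closed ball, late centres would be closer to [l] than the gap, although
   by [ds] they stay in the ball. *)
have sl n : cball (s n) l.
  rewrite /cball /= leNgt; apply/negP => nl.
  have /ul [N _ /(_ (n + N)%N (leq_addl _ _))/=] :
      nbhs l [set y | dist l y < dist (s n).1 l - (s n).2].
    by apply/dN; exists (dist (s n).1 l - (s n).2); rewrite ?subr_gt0.
  apply/negP; rewrite -leNgt lerBlDr (le_trans (dT _ (s (n + N)%N).1 _))//.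
  by rewrite addrC dC lerD2l ds// leq_addr.
have [n _] := WO l (s0W _ (sl 0%N)).
by apply; have [_ _] := sS n; apply; exact: sl.
Qed.

End polish.

(** * Measurability of category quantifiers *)

(** Preimages of a countable basis of the Polish space separate points, because its metric does. *)
Lemma standard_borel_separating (R : realType) (d : measure_display)
    (X : measurableType d) :
  standard_borel R X ->
  exists B : nat -> set X, (forall n, measurable (B n)) /\
    forall x y, (forall n, B n x <-> B n y) -> x = y.
Proof.
move=> [T [f [[sepT [dist dP]] fbij fB]]].
have [V [oV bV]] := separable_nat_basis dP sepT.
exists (fun n => f @^-1` V n); split.
  by move=> n; apply/fB; exact: sub_sigma_algebra.
move=> x y xy; apply: (bij_inj fbij).
have [d0 dE dC dT dN _] := dP.
apply: dE; apply/eqP; rewrite eq_le; apply/andP; split; last first.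
  by have := dT (f x) (f y) (f x); rewrite d0 [dist (f y) _]dC -mulr2n pmulrn_lge0.
rewrite leNgt; apply/negP => fxy.
have /bV[n Vfx /(_ (f y))] : nbhs (f x) [set z | dist (f x) z < dist (f x) (f y)].
  by apply/dN; exists (dist (f x) (f y)).
by rewrite /= ltxx => /(_ _)/notF[]; apply/xy.
Qed.

Section montgomery_novikov.
Context (T : ptopologicalType) (d : measure_display) (Y : measurableType d).
Variable V : nat -> set T.
Hypotheses (basisV : nat_basis V) (baireT : baire_space T).

Let slice (S : set (borel T * Y)) (y : Y) : set T := [set g | S (g, y)].

Let meager_slice_measurable (S : set (borel T * Y)) :=
  (forall y, baire_property (slice S y)) /\
  forall U : set T, open U -> measurable [set y | meager (U `&` slice S y)].

Let meager_slice_setC S :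
  meager_slice_measurable S -> meager_slice_measurable (~` S).
Proof.
move=> [bS mS]; split=> [y|U oU]; first exact: (baire_propertyC (bS y)).
pose good n := V n !=set0 /\ V n `<=` U.
(* Indices that are not [good] contribute [setT], so that the intersection can run over all of
   [nat]. *)
rewrite (_ : [set _ | _] = \bigcap_n (if pselect (good n) then
    ~` [set y | meager (V n `&` slice S y)] else setT)).
  apply: bigcap_measurable => [|n _]; first by exists 0%N.
  case: pselect => [?|?]; last exact: measurableT.
  by apply: measurableC; apply: mS; have [oV _] := basisV.
apply/seteqP; split=> y /=.
  move=> mU n _; case: pselect => [[Vn0 VnU] mV|?//].
  have [oV _] := basisV; apply: (baireT (oV n) Vn0).
  apply: meagerS (meagerU mU mV) => g Vg.
  by have [Sg|nSg] := pselect (S (g, y)); [right|left; split => //; exact: VnU].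
move=> h; apply: contrapT => /(baire_property_localization basisV oU _).
move=> /(_ (baire_propertyC (bS y)))[n [Vn0 VnU mV]].
have := h n I; case: pselect => [?|[]//]; apply.
by apply: meagerS mV => g [Vg Sg]; split.
Qed.

Let meager_slice_bigcup (S : nat -> set (borel T * Y)) :
  (forall n, meager_slice_measurable (S n)) ->
  meager_slice_measurable (\bigcup_n S n).
Proof.
move=> hS; split=> [y|U oU].
  rewrite (_ : slice _ _ = \bigcup_n slice (S n) y) //.
  by apply: baire_property_bigcup => n; have [+ _] := hS n.
rewrite (_ : [set _ | _] = \bigcap_n [set y | meager (U `&` slice (S n) y)]).
  apply: bigcap_measurable => [|n _]; first by exists 0%N.
  by have [_ +] := hS n; exact.
apply/seteqP; split=> y /=.
  by move=> m n _; apply: meagerS m => g [Ug Sg]; split => //; exists n.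
move=> h; apply: meagerS (meager_bigcup (fun n => h n I)) => g [Ug [n _ Sg]].
by exists n.
Qed.

Let meager_slice0 : meager_slice_measurable set0.
Proof.
split=> [y|U oU]; first exact/baire_property_open/open0.
rewrite (_ : [set _ | _] = setT) //; apply/seteqP; split => // y _ /=.
by apply: meagerS (meager0 T) => g [].
Qed.

Let sigma_algebra_meager_slice :
  sigma_algebra setT meager_slice_measurable.
Proof.
split; first exact: meager_slice0.
  by move=> S hS; rewrite setTD; exact: meager_slice_setC.
exact: meager_slice_bigcup.
Qed.

Let measurable_cst_prop (P : Prop) : measurable [set _ : Y | P].
Proof.
have [p|np] := pselect P.
  by rewrite (_ : [set _ | _] = setT)//; apply/seteqP; split.
by rewrite (_ : [set _ | _] = set0)//; apply/seteqP; split.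
Qed.

(* The induction over the product sigma-algebra carries the Baire property of
   the slices, because complements reduce to it: [U `\` S_y] is meager iff
   [S_y] is non-meager in every nonempty basic open subset of [U]. *)
Theorem montgomery_novikov (S : set (borel T * Y)) : measurable S ->
  (forall y, baire_property [set g : T | S (g, y)]) /\
  forall U : set T, open U ->
    measurable [set y | meager (U `&` [set g : T | S (g, y)])].
Proof.
suff : measurable `<=` meager_slice_measurable by exact.
apply: smallest_sub; first exact: sigma_algebra_meager_slice.
(* The generators are the preimages of measurable sets under the two projections; those coming from
   [borel T] need a further induction, starting from the open sets. *)
move=> _ [[D + <-]|[M mM <-]]; rewrite setTI.
  move: D; apply: smallest_sub.
    split.
    - rewrite /= preimage_set0; exact: meager_slice0.
    - by move=> D hD; rewrite /= setTD -preimage_setC; exact: meager_slice_setC.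
    - by move=> D hD; rewrite /= preimage_bigcup; exact: meager_slice_bigcup.
  move=> D oD; split=> [y|U oU]; first exact: (baire_property_open oD).
  exact: measurable_cst_prop (meager (U `&` D)).
split=> [y|U oU].
  have [My|nMy] := pselect (M y).
    rewrite (_ : slice _ _ = setT); first exact/baire_property_open/openT.
    by apply/seteqP; split => // g _; exact: My.
  rewrite (_ : slice _ _ = set0); first exact/baire_property_open/open0.
  by apply/seteqP; split => // g /nMy.
rewrite (_ : [set _ | _] = ~` M `|` [set _ | meager U]).
  by apply: measurableU => //; exact: measurableC.
apply/seteqP; split=> y /=.
  have [My m|] := pselect (M y); last by left.
  by right; apply: meagerS m => g Ug; split.
move=> [nMy|]; last by apply: meagerS => g [].
by apply: meagerS (meager0 T) => g [_ /nMy].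
Qed.

End montgomery_novikov.

(** * Right translations in a topological group *)

Lemma continuous_mulgr (G : topologicalGroupType) (h : G) :
  continuous (fun g : G => (g * h)%g).
Proof.
move=> g; apply: (cvg_comp (fun g : G => (g, h)) _ _ (mulg_continuous (g, h))).
by apply: cvg_pair; [exact: cvg_id|exact: cvg_cst].
Qed.

Lemma meager_mulgr (G : topologicalGroupType) (A : set G) (h : G) :
  meager A -> meager [set g | A (g * h)%g].
Proof.
move=> [ O hO AO].
have op k (W : set G) : open W -> open [set g | W (g * k)%g].
  by move=> oW; apply: (open_comp _ oW) => g _; exact: continuous_mulgr.
exists (fun n => [set g | O n (g * h)%g]); last first.
  by move=> g /AO[n _ nO]; exists n.
move=> n; have [oO dO] := hO n; split; first exact: op.
move=> W [w Ww] oW.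
have [x [/= Wx Ox]] : ([set g | W (g * h^-1)%g] `&` O n) !=set0.
  by apply: dO; [exists (w * h)%g; rewrite /= mulgK|exact: op].
by exists (x * h^-1)%g; rewrite /= mulgVK.
Qed.

Lemma mulgr_shrink (G : topologicalGroupType) (U : set G) (v : G) :
  open U -> U v ->
  exists W N : set G, [/\ nbhs v W, nbhs (1%g : G) N &
    forall w n, W w -> N n -> U (w * n)%g].
Proof.
move=> oU Uv.
have nU : nbhs (v * 1)%g U by rewrite mulg1; exact: open_nbhs_nbhs.
have [[W N] /= [nW nN] WN] := mulg_continuous (v, 1%g) U nU.
by exists W, N; split => // w n Ww Nn; exact: (WN (w, n)).
Qed.

(** * Whirly spatial actions are trivial *)

Section measure_lemmas.
Context (R : realType) (d : measure_display) (X : measurableType d).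
Variable mu : probability X R.

Lemma ae_le_measure (A B : set X) : measurable A -> measurable B ->
  {ae mu, forall x, A x -> B x} -> (mu A <= mu B)%E.
Proof.
move=> mA mB [N [mN N0 ABN]].
have AB : A `<=` B `|` N.
  move=> x Ax; have [Bx|nBx] := pselect (B x); first by left.
  by right; apply: ABN => /= /(_ Ax).
rewrite (le_trans (le_measure mu _ _ AB)) ?inE//; first exact: measurableU.
apply: (le_trans (measureU2 mu mB mN)).
by rewrite -[leRHS]adde0; apply: leeD => //; rewrite -N0.
Qed.

Lemma ae_exists (P : X -> Prop) (A : set X) : measurable A ->
  {ae mu, forall x, P x} -> (0 < mu A)%E -> exists2 x, A x & P x.
Proof.
move=> mA aeP A0; apply: contrapT => h; move: A0; apply/negP; rewrite -leNgt.
rewrite -(measure0 mu) ae_le_measure//.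
by apply: filterS aeP => x Px Ax; apply: h; exists x.
Qed.

Lemma measurable_fun_preimage (d' : measure_display) (Y : measurableType d')
    (f : X -> Y) (B : set Y) :
  measurable_fun [set: X] f -> measurable B -> measurable (f @^-1` B).
Proof. by move=> mf mB; rewrite -[_ @^-1` _]setTI; exact: mf. Qed.

End measure_lemmas.

Section spatial.
Context (R : realType) (G : topologicalGroupType).
Context (d : measure_display) (Y : measurableType d).
Variables (nu : probability Y R) (b : G -> Y -> Y).
Hypotheses (polishG : polish_space R G) (stdY : standard_borel R Y).
Hypotheses (spb : spatial_action nu b) (wb : whirly nu b).

(* The set [E_U] of the header. *)
Let avoid (B : set Y) (U : set G) : set Y :=
  [set y | meager (U `&` [set g | B (b g y)])].

Let measurable_avoid (B : set Y) (U : set G) :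
  measurable B -> open U -> measurable (avoid B U).
Proof.
move=> mB oU; have [sepG [dist dP]] := polishG.
have [V basisV] := separable_nat_basis dP sepG.
have mS := measurable_fun_preimage (spatial_action_borel spb) mB.
by have [_ /(_ U oU)] := montgomery_novikov basisV (complete_baire_space dP) mS.
Qed.

Let orbit_baire_property (B : set Y) (y : Y) :
  measurable B -> baire_property [set g | B (b g y)].
Proof.
move=> mB; have [sepG [dist dP]] := polishG.
have [V basisV] := separable_nat_basis dP sepG.
have mS := measurable_fun_preimage (spatial_action_borel spb) mB.
by have [/(_ y)] := montgomery_novikov basisV (complete_baire_space dP) mS.
Qed.

(** The set of [g] moving [b n y] into [B] is a right translate of the one for [y]. This uses the
    action law at one fixed [y] for all [g], which a near-action does not provide. *)
Let avoid_translate (B : set Y) (U W : set G) (n : G) (y : Y) :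
  (forall w, W w -> U (w * n)%g) -> avoid B U y -> avoid B W (b n y).
Proof.
move=> WU /(meager_mulgr n); apply: meagerS => g [Wg /=].
by rewrite (spatial_actionM spb) => Bg; split => //; exact: WU.
Qed.

(** Otherwise whirliness, applied to the complement of [avoid B W] and to [avoid B U], gives [g] in
    [N] and [x] outside [avoid B W] with [b g^-1 x] in [avoid B U], against [avoid_translate]. *)
Let whirly_avoid (B : set Y) (U W N : set G) :
  measurable B -> open U -> open W -> nbhs (1%g : G) N ->
  (forall w n, W w -> N n -> U (w * n)%g) ->
  (0 < nu (avoid B U))%E -> nu (~` avoid B W) = 0%E.
Proof.
move=> mB oU oW nN WNU U0; apply/eqP; rewrite eq_le measure_ge0 andbT leNgt.
apply/negP => W0.
have mW : measurable (~` avoid B W) by apply: measurableC; exact: measurable_avoid.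
have [g Ng] := wb mW (measurable_avoid mB oU) W0 U0 nN.
rewrite (_ : _ `&` _ = set0) ?measure0 ?ltxx//.
apply/seteqP; split=> // x [nWx Ugx]; apply: nWx.
have := avoid_translate (fun w Ww => WNU w g Ww Ng) Ugx.
by rewrite (spatial_actionM spb) mulgV (spatial_action1 spb).
Qed.

Lemma whirly_spatial_trivial : ~ nontrivial_probability nu.
Proof.
move=> [C mC /andP[C0 C1]].
have [sepG [dist dP]] := polishG.
have baireG := complete_baire_space dP.
have [V basisV] := separable_nat_basis dP sepG; have [oV bV] := basisV.
have [B [mB sepB]] := standard_borel_separating stdY.
(* Countably many conditions, each excluding at most a null set; any two points that satisfy them
   turn out to be equal. *)
pose generic y := forall n k,
  (nu (avoid (B n) (V k)) = 0%E -> ~ avoid (B n) (V k) y) /\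
  (nu (~` avoid (B n) (V k)) = 0%E -> avoid (B n) (V k) y).
have ae_generic : {ae nu, forall y, generic y}.
  apply: ae_foralln => n; apply: ae_foralln => k.
  have mA := measurable_avoid (mB n) (oV k).
  apply: filterI.
    have [A0|] := pselect (nu (avoid (B n) (V k)) = 0%E).
      exists (avoid (B n) (V k)); split => // y /= h; apply: contrapT => nA.
      by apply: h => _.
    by move=> A0; apply: aeW => y /A0.
  have [A0|] := pselect (nu (~` avoid (B n) (V k)) = 0%E).
    exists (~` avoid (B n) (V k)); split => //; first exact: measurableC.
    by move=> y /= h Ay; apply: h.
  by move=> A0; apply: aeW => y /A0.
(* As [z] is generic, [avoid (B n) (V k)] is not null. Every point of [V k] lies in some [V i] whose
   product with a neighborhood of 1 stays in [V k]; then [avoid (B n) (V i)] is co-null and contains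
   [y]. Countably many such [V i] cover [V k]. *)
have generic_meager y z n k : generic y -> generic z ->
    avoid (B n) (V k) z -> avoid (B n) (V k) y.
  move=> gy gz Az.
  have Ak0 : (0 < nu (avoid (B n) (V k)))%E.
    rewrite lt_neqAle measure_ge0 andbT; apply/eqP => A0.
    by have [/(_ (esym A0))] := gz n k.
  apply: (@meagerS _ _ (\bigcup_i (if pselect (avoid (B n) (V i) y) then
      V i `&` [set g | B n (b g y)] else set0))).
    move=> g [Vg Bg].
    have [W [N [nW nN WN]]] := mulgr_shrink (oV k) Vg.
    have [i Vig ViW] := bV g W nW.
    have Ai : avoid (B n) (V i) y.
      have [_ +] := gy n i; apply; apply: (whirly_avoid _ _ _ nN _ Ak0) => //.
      by move=> w m /ViW; exact: WN.
    by exists i => //; case: pselect.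
  apply: meager_bigcup => i; case: pselect => [//|?]; exact: meager0.
(* Otherwise some nonempty [V k] is, up to a meager set, contained in the difference. There [z]
   avoids [B n], hence so does [y], and [V k] would be meager. *)
have generic_diff y z n : generic y -> generic z ->
    meager ([set g | B n (b g y)] `\` [set g | B n (b g z)]).
  move=> gy gz; apply: contrapT => nm.
  have bp := baire_propertyD (orbit_baire_property y (mB n))
               (orbit_baire_property z (mB n)).
  have [|k [Vk0 _ mV]] := baire_property_localization basisV openT bp.
    by rewrite setTI.
  have Az : avoid (B n) (V k) z.
    by apply: meagerS mV => g [Vg Bg]; split => // -[].
  apply: (baireG _ (oV k) Vk0).
  apply: meagerS (meagerU mV (generic_meager y z n k gy gz Az)) => g Vg.
  have [Bg|nBg] := pselect (B n (b g y)); first by right.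
  by left; split => // -[].
have generic_eq y z : generic y -> generic z -> y = z.
  move=> gy gz.
  have m : meager (\bigcup_n (([set g | B n (b g y)] `\` [set g | B n (b g z)])
      `|` ([set g | B n (b g z)] `\` [set g | B n (b g y)]))).
    by apply: meager_bigcup => n; apply: meagerU; exact: generic_diff.
  have [g ng] : exists g : G, forall n, B n (b g y) <-> B n (b g z).
    apply: contrapT => h; apply: (baireG _ openT); first by exists 1%g.
    apply: meagerS m => g _; apply: contrapT => ng; apply: h; exists g => n.
    split=> Bg; apply: contrapT => nBg; apply: ng; exists n => //.
      by left.
    by right.
  have := congr1 (b g^-1%g) (sepB _ _ ng).
  by rewrite !(spatial_actionM spb) mulVg !(spatial_action1 spb).
(* [C] and its complement are both non-null, so each contains a generic point. *)
have [y Cy gy] := ae_exists mC ae_generic C0.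
have [|z nCz gz] := ae_exists (measurableC mC) ae_generic.
  by rewrite probability_setC// sube_gt0.
by apply: nCz; rewrite (generic_eq z y).
Qed.

End spatial.

(** * Factors and isomorphic copies *)

Lemma whirly_factor (R : realType) (G : topologicalGroupType)
    (d d' : measure_display) (X : measurableType d) (Y : measurableType d')
    (mu : probability X R) (a : G -> X -> X)
    (nu : probability Y R) (b : G -> Y -> Y) (f : X -> Y) :
  (forall g, measurable_fun [set: X] (a g)) ->
  (forall g, measurable_fun [set: Y] (b g)) ->
  measure_preserving mu nu f -> equivariant_mod0 mu a b f ->
  whirly mu a -> whirly nu b.
Proof.
move=> ma mb [mf f_mu] eqf wa A B mA mB A0 B0 U nU.
have mfA := measurable_fun_preimage mf mA.
have mfB := measurable_fun_preimage mf mB.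
have [|| g Ug gAB] := wa _ _ mfA mfB _ _ U nU; rewrite ?f_mu//.
have mAB : measurable (A `&` translate b g B).
  by apply: measurableI => //; exact: measurable_fun_preimage.
exists g => //; rewrite -f_mu// (lt_le_trans gAB)// ae_le_measure//.
- by apply: measurableI => //; exact: measurable_fun_preimage.
- exact: measurable_fun_preimage.
(* Equivariance is taken at [g^-1], because [translate] acts through the inverse. *)
- apply: filterS (eqf g^-1%g) => x /= fa [Ax Bx]; split => //.
  by rewrite /translate /= -fa.
Qed.

Lemma equivariant_mod0_comp (R : realType) (G : topologicalGroupType)
    (d1 d2 d3 : measure_display) (X : measurableType d1)
    (Y : measurableType d2) (Z : measurableType d3)
    (mu : probability X R) (a : G -> X -> X)
    (nu : probability Y R) (b : G -> Y -> Y) (c : G -> Z -> Z)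
    (f : X -> Y) (h : Y -> Z) :
  measure_preserving mu nu f ->
  equivariant_mod0 mu a b f -> equivariant_mod0 nu b c h ->
  equivariant_mod0 mu a c (h \o f).
Proof.
move=> [mf f_mu] eqf eqh g.
have [N [mN N0 hN]] := eqh g.
have : {ae mu, forall x, h (b g (f x)) = c g (h (f x))}.
  exists (f @^-1` N); split; first exact: measurable_fun_preimage.
    by rewrite f_mu.
  by move=> x /= nh; apply: hN.
by apply: filterS2 (eqf g) => x /= ->.
Qed.

Lemma measure_preserving_comp (R : realType)
    (d1 d2 d3 : measure_display) (X : measurableType d1)
    (Y : measurableType d2) (Z : measurableType d3)
    (mu : probability X R) (nu : probability Y R) (rho : probability Z R)
    (f : X -> Y) (h : Y -> Z) :
  measure_preserving mu nu f -> measure_preserving nu rho h ->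
  measure_preserving mu rho (h \o f).
Proof.
move=> [mf f_mu] [mh h_nu]; split; first exact: measurableT_comp.
by move=> B mB; rewrite -h_nu// -f_mu//; exact: measurable_fun_preimage.
Qed.

(** Pulling [B] back along the mod 0 inverse [h] keeps its measure, as [h \o f] is almost everywhere
    the identity. *)
Lemma nontrivial_isomorphic (R : realType) (d d' : measure_display)
    (X : measurableType d) (Y : measurableType d')
    (mu : probability X R) (nu : probability Y R) (f : X -> Y) :
  measure_preserving mu nu f -> invertible_mod0 mu nu f ->
  nontrivial_probability mu -> nontrivial_probability nu.
Proof.
move=> [mf f_mu] [h [mh hf _]] [B mB B01].
exists (h @^-1` B); first exact: measurable_fun_preimage.
rewrite -f_mu; last exact: measurable_fun_preimage.
rewrite (_ : mu _ = mu B)//; apply/eqP; rewrite eq_le.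
have mhB : measurable (f @^-1` (h @^-1` B)).
  by do 2 apply: measurable_fun_preimage => //.
by apply/andP; split; apply: ae_le_measure => //; apply: filterS hf => x /= ->.
Qed.

(** A spatial model of the factor is itself a factor of [a], through [h \o f], so it is whirly and
    therefore trivial, whereas nontriviality passes to it by the isomorphism. *)
Lemma whirly_no_spatial_factor (R : realType) (G : topologicalGroupType)
    (d d' : measure_display) (X : measurableType d) (Y : measurableType d')
    (mu : probability X R) (a : G -> X -> X)
    (nu : probability Y R) (b : G -> Y -> Y) (f : X -> Y) :
  polish_space R G -> near_action mu a -> whirly mu a ->
  measure_preserving mu nu f -> equivariant_mod0 mu a b f ->
  nontrivial_probability nu -> ~ has_spatial_model nu b.
Proof.
move=> polG naa wa pf eqf ntnu [d'' [Z [rho [c [stdZ spc [h [ph ih eqh]]]]]]].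
apply: (whirly_spatial_trivial polG stdZ spc); last first.
  exact: (nontrivial_isomorphic ph ih ntnu).
apply: (whirly_factor _ _ (measure_preserving_comp pf ph)
          (equivariant_mod0_comp pf eqf eqh) wa) => g.
  by have [] := near_action_preserving naa g.
by have [] := spatial_action_preserving spc g.
Qed.

(** * G-continuous functions *)

Lemma measurable_sublevel (R : realType) (d : measure_display)
    (X : measurableType d) (f : X -> R) (s : R) :
  measurable_fun [set: X] f -> measurable [set x | f x < s].
Proof.
move=> mf; rewrite (_ : [set _ | _] = f @^-1` `]-oo, s[%classic).
  exact: measurable_fun_preimage.
by apply/seteqP; split=> x /=; rewrite in_itv.
Qed.

Lemma measurable_superlevel (R : realType) (d : measure_display)
    (X : measurableType d) (f : X -> R) (t : R) :
  measurable_fun [set: X] f -> measurable [set x | t < f x].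
Proof.
move=> mf; rewrite (_ : [set _ | _] = f @^-1` `]t, +oo[%classic).
  exact: measurable_fun_preimage.
by apply/seteqP; split=> x /=; rewrite in_itv/= andbT.
Qed.

(** The candidate constant is the essential infimum [sup S]: if no [s < t] separate [f], then [f] is
    almost everywhere at most any number above it. *)
Lemma ae_cst_or_separated (R : realType) (d : measure_display)
    (X : measurableType d) (mu : probability X R) (f : X -> R) :
  measurable_fun [set: X] f ->
  (exists c, {ae mu, forall x, f x = c}) \/
  exists s t, [/\ s < t, (0 < mu [set x | (f x < s)%R])%E &
                (0 < mu [set x | (t < f x)%R])%E].
Proof.
move=> mf; apply: contrapT => /not_orP[ncst nsep].
have mlt s := measurable_sublevel s mf.
have mgt t := measurable_superlevel t mf.
pose S := [set s | mu [set x | f x < s] = 0%E].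
have notS s t : ~ S s -> s < t -> mu [set x | t < f x] = 0%E.
  move=> nSs st; apply: contrapT => t0; apply: nsep; exists s, t; split => //.
    by rewrite lt_neqAle measure_ge0 andbT; apply/eqP => /esym.
  by rewrite lt_neqAle measure_ge0 andbT; apply/eqP => /esym.
have ae_not_lt s : S s -> {ae mu, forall x, ~ f x < s}.
  by move=> Ss; exists [set x | f x < s]; split => // x /= /contrapT.
have ae_not_gt s t : ~ S s -> s < t -> {ae mu, forall x, ~ t < f x}.
  by move=> nSs st; exists [set x | t < f x]; split => //;
    [exact: (notS s)|move=> x /= /contrapT].
have ae_false : ~ {ae mu, forall x, False}.
  move=> h; have [] := @ae_exists R _ X mu _ setT measurableT h.
    by rewrite probability_setT lte01.
  by [].
have Sdown s t : s <= t -> S t -> S s.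
  move=> st St; apply: (subset_measure0 _ _ _ St) => //.
  by move=> x /= fs; exact: lt_le_trans fs st.
(* If [S] were empty, [f] would be almost everywhere at most every [- n%:R]. *)
have S0 : S !=set0.
  apply: contrapT => nS; apply: ae_false.
  have : {ae mu, forall x (n : nat), ~ - n%:R < f x}.
    apply: ae_foralln => n; apply: (ae_not_gt (- n%:R - 1)).
      by move=> Sn; apply: nS; exists (- n%:R - 1).
    by rewrite ltrBlDr ltrDl.
  apply: filterS => x h; apply: (h (Num.truncn (- f x)).+1).
  by rewrite ltrNl truncnS_gt.
have Sub : has_ubound S.
  apply: contrapT => nub; apply: ae_false.
  have : {ae mu, forall x (n : nat), ~ f x < n%:R}.
    apply: ae_foralln => n; apply: ae_not_lt; apply: contrapT => nS.
    apply: nub; exists n%:R => s Ss; rewrite leNgt; apply/negP => /ltW ns.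
    exact: nS (Sdown _ _ ns Ss).
  apply: filterS => x h.
  exact: h (truncnS_gt (f x)).
apply: ncst; exists (sup S).
have h1 : {ae mu, forall x (n : nat), ~ f x < sup S - n.+1%:R^-1}.
  apply: ae_foralln => n; apply: ae_not_lt.
  have [s Ss /ltW ns] : exists2 s, S s & sup S - n.+1%:R^-1 < s.
    by apply: sup_adherent => //; rewrite invr_gt0.
  exact: Sdown ns Ss.
have h2 : {ae mu, forall x (n : nat), ~ sup S + n.+1%:R^-1 < f x}.
  (* Half of the gap gives a number above [sup S], hence outside [S], and still strictly below the
     threshold. *)
  apply: ae_foralln => n; apply: (ae_not_gt (sup S + n.+1%:R^-1 / 2)).
    move=> Sn; have := ub_le_sup Sub Sn; rewrite gerDl leNgt.
    by rewrite divr_gt0// invr_gt0.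
  by rewrite ltrD2l ltr_pdivrMr// ltr_pMr ?invr_gt0// ltr1n.
apply: filterS2 h1 h2 => x h1 h2; apply/eqP; rewrite eq_le; apply/andP; split.
  rewrite leNgt; apply/negP => /ltr_add_invr[n xn]; exact: h2 xn.
by rewrite leNgt; apply/negP => /ltr_add_invr[n xn]; apply: (h1 n); rewrite ltrBrDr.
Qed.

Lemma whirly_G_continuous_cst (R : realType) (G : topologicalGroupType)
    (d : measure_display) (X : measurableType d)
    (mu : probability X R) (a : G -> X -> X) (f : X -> R) :
  polish_space R G -> (forall g, measurable_fun [set: X] (a g)) ->
  whirly mu a -> measurable_fun [set: X] f -> G_continuous mu a f ->
  exists c : R, {ae mu, forall x, f x = c}.
Proof.
move=> [_ [dist [_ _ _ _ dN _]]] ma wa mf cf.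
have [//|[s [t [st s0 t0]]]] := ae_cst_or_separated mu mf.
have mlt := measurable_sublevel s mf; have mgt := measurable_superlevel t mf.
(* [translate a g] evaluates at [g^-1], so the inverses are the ones kept within [1/(n+1)] of 1. *)
have /choice[g gP] : forall n : nat, exists g : G,
    dist 1%g (g^-1)%g < n.+1%:R^-1 /\
    (0 < mu ([set x | (f x < s)%R] `&` translate a g [set x | (t < f x)%R]))%E.
  move=> n.
  have nU : nbhs (1%g : G) [set g | dist 1%g (g^-1)%g < n.+1%:R^-1].
    have : nbhs ((1 : G)^-1)%g [set g : G | dist 1%g g < n.+1%:R^-1].
      by rewrite invg1; apply/dN; exists n.+1%:R^-1.
    exact: invg_continuous.
  by have [g Ug Pg] := wa _ _ mlt mgt s0 t0 _ nU; exists g.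
have g1 : (fun n => (g n)^-1)%g @ \oo --> (1%g : G).
  move=> A /dN[e e0 eA].
  have [k] := ltr_add_invr e0; rewrite add0r => ke.
  exists k => // n /= kn; apply: eA; have [gn _] := gP n.
  rewrite /= (lt_trans gn)// (le_lt_trans _ ke)// lef_pV2 ?posrE//.
  by rewrite ler_nat.
have /= /(_ [set z | (z < (t - s)%:E)%E])[] := cf _ g1.
  apply: open_nbhs_nbhs; split; first exact: open_ereal_lt_ereal.
  by rewrite /= lte_fin subr_gt0.
move=> n _ /(_ n (leqnn n)) /=.
rewrite unlock /= probability_setT lte01 => Nlt.
have mAB : measurable ([set x | f x < s] `&` translate a (g n) [set x | t < f x]).
  by apply: measurableI => //; exact: measurable_fun_preimage.
(* A point of the overlap at which the essential supremum does bound the difference; there the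
   difference exceeds [t - s]. *)
have [x [/= fxs fgx]] := ae_exists mAB (ess_sup_ge mu
  (abse \o (fun x => (f (a (g n)^-1%g x) - f x)%:E))) (gP n).2.
move=> /le_lt_trans/(_ Nlt); rewrite /= lte_fin ltNge => /negP[].
exact: le_trans (lerB (ltW fgx) (ltW fxs)) (ler_norm _).
Qed.

(** The absence of a spatial model is the case of the identity factor map. Trivial [mu] is excluded
    there, since an action on a one-point space is both whirly and spatial. *)
Theorem proposition3p3 (R : realType) (G : topologicalGroupType)
    (d : measure_display) (X : measurableType d)
    (mu : probability X R) (a : G -> X -> X) :
  polish_space R G ->
  standard_borel R X ->
  near_action mu a ->
  (whirly mu a ->
     forall f : X -> R, f \in Lfun mu +oo%E -> G_continuous mu a f ->
     exists c : R, {ae mu, forall x, f x = c}) /\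
  (whirly mu a ->
     (nontrivial_probability mu -> ~ has_spatial_model mu a) /\
     ~ (exists (d' : measure_display) (Y : measurableType d')
          (nu : probability Y R) (b : G -> Y -> Y),
          [/\ near_action_factor mu a nu b, has_spatial_model nu b &
              nontrivial_probability nu])).
Proof.
move=> polG _ naa; split.
  move=> wa f /[!inE] /andP[/[!inE] mf _] cf.
  apply: (whirly_G_continuous_cst polG _ wa _ cf) => // g.
  by have [] := near_action_preserving naa g.
move=> wa; split.
  move=> ntmu; apply: (whirly_no_spatial_factor (f := idfun) polG naa wa) => //.
  - by split=> //; exact: measurable_id.
  - by move=> g; apply: aeW.
move=> [d' [Y [nu [b [[_ _ [f pf eqf]] spm ntnu]]]]].
exact: (whirly_no_spatial_factor polG naa wa pf eqf ntnu spm).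
Qed.
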